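(* Let $k\geq 1$. The generating function of the number of edges of the Munarini graphs $M_{n,k}$ is $$\sum_{n\geq 0}|E(M_{n,k})|\,t^n=\frac{(k-1)t+t^2}{(1-kt-t^2)^2}$$ as formal power series in $t$.
   Context: For integers $k\geq 1$, $n\geq 0$, a $k$-generalized Pell string of length $n$ is a word of length $n$ over the alphabet $\{0,1,\ldots,k\}$ in which every maximal run of the character $k$ has even length (equivalently, a concatenation of letters from $\{0,1,\ldots,k-1,kk\}$). Let $\mathcal{F}_{n,k}$ be the set of these strings (for $n=0$ it contains only the empty string). The Munarini graph $M_{n,k}$ is the simple graph with vertex set $\mathcal{F}_{n,k}$ in which two vertices are adjacent if one of them can be obtained from the other either by replacing one occurrence of $0$ with some $i\in\{1,\ldots,k-1\}$, or by replacing one substring $00$ (two consecutive positions) with $kk$ (both replacements may be read in either direction, and both strings must be in $\mathcal{F}_{n,k}$). *)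

(* Defs.v *)
From HB Require Import structures.
From mathcomp Require Import all_boot all_order all_algebra.

Set Implicit Arguments.
Unset Strict Implicit.
Unset Printing Implicit Defensive.

Import GRing.Theory.

Section PellStrings.

Variables n k : nat.

Local Notation word := (n.-tuple 'I_k.+1).

(* The letter k is [ord_max : 'I_k.+1] and the letter 0 is [ord0].  The run
   [i, j[ consists of the positions i, ..., j - 1. *)
Definition maximal_run (s : word) (i j : nat) : bool :=
  [&& i < j <= n,
      [forall l : 'I_n, (i <= l < j) ==> (tnth s l == ord_max)],
      [forall l : 'I_n, (l.+1 == i) ==> (tnth s l != ord_max)] &
      [forall l : 'I_n, (l == j :> nat) ==> (tnth s l != ord_max)]].

Definition pell_string (s : word) : bool :=
  [forall i : 'I_n.+1, forall j : 'I_n.+1,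
     maximal_run s i j ==> ~~ odd (j - i)].

Definition munarini_vertex : finType := {s : word | pell_string s}.

Definition replace_letter (s t : word) : bool :=
  [exists p : 'I_n,
     [&& tnth s p == ord0, 0 < tnth t p < k &
         [forall q : 'I_n, (q != p) ==> (tnth t q == tnth s q)]]].

Definition replace_pair (s t : word) : bool :=
  [exists p : 'I_n, exists p' : 'I_n,
     [&& p' == p.+1 :> nat,
         (tnth s p == ord0) && (tnth s p' == ord0),
         (tnth t p == ord_max) && (tnth t p' == ord_max) &
         [forall q : 'I_n,
            (q != p) && (q != p') ==> (tnth t q == tnth s q)]]].

Definition munarini_adj : rel munarini_vertex :=
  fun x y => [|| replace_letter (val x) (val y),
                 replace_letter (val y) (val x),
                 replace_pair (val x) (val y) |
                 replace_pair (val y) (val x)].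

Definition munarini_edges : {set {set munarini_vertex}} :=
  [set e : {set munarini_vertex} |
     [exists x, exists y, munarini_adj x y && (e == [set x; y])]].

End PellStrings.

Local Open Scope ring_scope.

Section FormalPowerSeries.

Variable R : comUnitRingType.

(* A formal power series is its sequence of coefficients. *)
Definition fps : Type := nat -> R.

Definition fps_of_poly (p : {poly R}) : fps := fun n => p`_n.

Definition fps_mul (a b : fps) : fps :=
  fun n => \sum_(i < n.+1) a i * b (n - i)%N.

(* The coefficients 0, ..., n of the inverse series, obtained by solving
   a * b = 1 for b; meaningful when a 0 is a unit. *)
Fixpoint fps_inv_coefs (a : fps) (n : nat) : seq R :=
  if n is m.+1 then
    let s := fps_inv_coefs a m in
    rcons s (- (a 0%N)^-1 * \sum_(i < m.+1) s`_i * a (m.+1 - i)%N)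
  else [:: (a 0%N)^-1].

Definition fps_inv (a : fps) : fps := fun n => (fps_inv_coefs a n)`_n.

Definition fps_div (a b : fps) : fps := fps_mul a (fps_inv b).

Lemma size_fps_inv_coefs a n : size (fps_inv_coefs a n) = n.+1.
Proof. by elim: n => //= n IH; rewrite size_rcons IH. Qed.

Lemma nth_fps_inv_coefs a n i :
  (i <= n)%N -> (fps_inv_coefs a n)`_i = fps_inv a i.
Proof.
elim: n => [|n IH]; first by rewrite leqn0 => /eqP->.
rewrite leq_eqVlt => /orP[/eqP->//|]; rewrite ltnS => le_in.
by rewrite /= nth_rcons size_fps_inv_coefs ltnS le_in IH.
Qed.

Lemma fps_mulVr (a : fps) : a 0%N \is a GRing.unit ->
  fps_mul (fps_inv a) a =1 fps_of_poly 1.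
Proof.
move=> ua [|n]; rewrite /fps_mul /fps_of_poly coef1.
  by rewrite big_ord_recr big_ord0 /= add0r /fps_inv /= mulVr.
rewrite big_ord_recr /= subnn {2}/fps_inv /=.
rewrite nth_rcons size_fps_inv_coefs ltnn eqxx.
rewrite mulNr mulNr mulrAC mulVr // mul1r.
apply/eqP; rewrite subr_eq0; apply/eqP; apply: eq_bigr => i _.
by rewrite nth_fps_inv_coefs // -ltnS.
Qed.

End FormalPowerSeries.

(* Main.v *)
(** A k-Pell word is a unique concatenation of the blocks 0, ..., k-1 and kk,
    so the numbers F of words satisfy F(t) (1 - k t - t^2) = 1.  Every edge has
    exactly one orientation that lowers the number of zeros; such an arc either
    changes the first block (k-1 ways for a one-letter block 0, one way for the
    pair 00) or keeps it and is an arc of the remaining words.  Hence the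
    numbers E of edges satisfy
    E(t) (1 - k t - t^2) = ((k-1) t + t^2) F(t). *)
Require Import Defs.
From HB Require Import structures.
From mathcomp Require Import all_boot all_order all_algebra.
From mathcomp Require Import zify ring.

Set Implicit Arguments.
Unset Strict Implicit.
Unset Printing Implicit Defensive.

Import GRing.Theory.

(** * Parity of the runs in boolean words *)

Fixpoint even_true_runs (b : seq bool) : bool :=
  match b with
  | [::] => true
  | false :: b' => even_true_runs b'
  | true :: true :: b' => even_true_runs b'
  | true :: _ => false
  end.

(** Reading past the end gives [false], so a run may end at the last position without a special
    case; at [i = 0] the condition on the left neighbour is vacuous. *)
Definition true_run (b : seq bool) (i j : nat) : Prop :=
  [/\ i < j, (forall l, i <= l < j -> nth false b l),
      (forall l, l.+1 = i -> ~~ nth false b l) & ~~ nth false b j].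

(** Deleting a leading pair of [true] shortens a run starting at 0 by two and shifts every other
    run, so parities survive. The induction is on a bound for the size, because the recursion may
    drop two letters at once. *)
Lemma even_true_runsP (b : seq bool) :
  reflect (forall i j, true_run b i j -> ~~ odd (j - i)) (even_true_runs b).
Proof.
apply: (iffP idP).
- have [m] := ubnP (size b).
  elim: m b => // m IH [|[] b] /=.
  + by move=> _ _ i j [ij /(_ i)]; rewrite nth_nil leqnn ij => /(_ isT).
  + case: b => [|[] b] //= lt_bm eb [|[|i]] j [ij Hr Hp Hj].
    * case: j ij Hr Hj => [|[|[|j]]] // _ Hr Hj.
      rewrite subn0 /= negbK.
      have := IH b _ eb 0 j.+1; rewrite subn0 /=; apply; first by lia.
      by split=> // l Hl; apply: (Hr l.+2); lia.
    * by have := Hp 0 erefl.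
    * case: j ij Hr Hj => [|[|j]] // ij Hr Hj; rewrite !subSS.
      apply: (IH b) => //; first by lia.
      split=> // l Hl; first by apply: (Hr l.+2).
      by apply: (Hp l.+2); rewrite Hl.
  + move=> lt_bm eb [|i] [|j] [ij Hr Hp Hj] //.
      by have := Hr 0 isT.
    rewrite subSS; apply: (IH b) => //.
    split=> // l Hl; first by apply: (Hr l.+1).
    by apply: (Hp l.+1); rewrite Hl.
- have [m] := ubnP (size b).
  elim: m b => // m IH [|[] b] //=.
  + case: b => [|[] b] //= lt_bm H.
    (* A lone leading [true] is itself a run of length one, which the hypothesis forbids. *)
    * by suff /H : true_run (true :: [::]) 0 1 by []; split=> // -[|l].
    * apply: IH => [|i j [ij Hr Hp Hj]]; first by lia.
      (* A run of [b] starting at 0 absorbs the leading pair and stays at 0; any other run is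
         shifted by two. *)
      case: i ij Hr Hp => [|i] ij Hr Hp.
        have := H 0 j.+2; rewrite !subn0 /= negbK; apply.
        by split=> // -[|[|l]] //= Hl; apply: Hr.
      have := H i.+3 j.+2; rewrite 2!subSS; apply.
      split=> // [[|[|l]]|[|[|l]]] //= Hl.
        exact: Hr.
      by apply: Hp; lia.
    * by suff /H : true_run (true :: false :: b) 0 1 by []; split=> // -[|l].
  + move=> lt_bm H; apply: IH => [//|i j [ij Hr Hp Hj]].
    have := H i.+1 j.+1; rewrite subSS; apply; split=> // [[|l]|[|l]] //= Hl.
      exact: Hr.
    by apply: Hp; lia.
Qed.

Lemma eq_take_drop (T : Type) (x0 : T) (s t : seq T) (p q : nat) :
    size s = size t -> p <= q ->
    (forall i, ~~ (p <= i < q) -> nth x0 s i = nth x0 t i) ->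
  take p s = take p t /\ drop q s = drop q t.
Proof.
move=> sz pq E; split; apply: (@eq_from_nth _ x0).
- by rewrite !size_take sz.
- by rewrite size_take_min => i; rewrite leq_min => /andP[ip _];
    rewrite !nth_take // E //; lia.
- by rewrite !size_drop sz.
- by move=> i _; rewrite !nth_drop E //; lia.
Qed.

(** * Pell strings as sequences of letters *)

Section PellWords.

Variable k : nat.
Hypothesis k_gt0 : 0 < k.

Local Notation letter := 'I_k.+1.
Local Notation zero := (ord0 : letter).
Local Notation top := (ord_max : letter).

Definition pell_word (s : seq letter) := even_true_runs (map (pred1 top) s).

Lemma zero_neq_top : (zero == top) = false.
Proof. by apply/negbTE; rewrite -val_eqE /= neq_ltn k_gt0. Qed.

Lemma top_neq_zero : (top == zero) = false.
Proof. by rewrite eq_sym zero_neq_top. Qed.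

Lemma nth_top n (s : n.-tuple letter) (l : 'I_n) :
  nth false (map (pred1 top) s) l = (tnth s l == top).
Proof. by rewrite (nth_map zero) ?size_tuple // (tnth_nth zero). Qed.

Lemma maximal_runP n (s : n.-tuple letter) (i j : nat) :
  reflect (true_run (map (pred1 top) s) i j) (maximal_run s i j).
Proof.
apply: (iffP and4P).
- case=> /andP[ij jn] /forallP Hr /forallP Hp /forallP Hj.
  split=> // [l /andP[il lj]|l li|].
  + have ln : l < n by lia.
    by have := Hr (Ordinal ln); rewrite -nth_top /= il lj.
  + have ln : l < n by lia.
    by have := Hp (Ordinal ln); rewrite -nth_top /= li eqxx.
  + case: (ltnP j n) => [jn'|nj]; last first.
      by rewrite nth_default // size_map size_tuple.
    by have := Hj (Ordinal jn'); rewrite -nth_top /= eqxx.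
- case=> ij Hr Hp Hj; split.
  (* If [j] exceeded [n], position [j.-1] would lie in the run and yet read the default [false]. *)
  + rewrite ij /=; case: leqP => // nj; have := Hr j.-1.
    by rewrite nth_default ?size_map ?size_tuple; [move=> H; apply: H; lia|lia].
  + by apply/forallP=> l; apply/implyP => Hl; rewrite -nth_top Hr.
  + by apply/forallP=> l; apply/implyP => /eqP Hl; rewrite -nth_top Hp.
  + by apply/forallP=> l; apply/implyP => /eqP Hl; rewrite -nth_top Hl.
Qed.

Lemma pell_stringE n (s : n.-tuple letter) : pell_string s = pell_word s.
Proof.
apply/forallP/even_true_runsP => [H i j Hij|H i].
  have /and4P[/andP[ij jn] _ _ _] := introT (maximal_runP s i j) Hij.
  have iN : i < n.+1 by lia.
  have jN : j < n.+1 by lia.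
  have /forallP/(_ (Ordinal jN))/implyP := H (Ordinal iN).
  by apply; apply/maximal_runP.
by apply/forallP=> j; apply/implyP => /maximal_runP; apply: H.
Qed.

(** * Edges oriented towards fewer zeros *)

Definition middle (i : letter) := 0 < i < k.

(** Recursion on the first letters is chosen to match the enumeration by first block; neither word
    is required to be Pell here. *)
Fixpoint raises (s t : seq letter) : bool :=
  match s, t with
  | x :: s', y :: t' =>
    [|| [&& x == zero, middle y & s' == t'],
        (x == y) && raises s' t' |
        [&& x == zero, y == top, ohead s' == Some zero, ohead t' == Some top
          & behead s' == behead t']]
  | _, _ => false
  end.

Lemma raisesP (s t : seq letter) :
  reflect ((exists u v i, [/\ middle i, s = u ++ zero :: v & t = u ++ i :: v]) \/
           (exists u v, s = u ++ [:: zero, zero & v] /\ t = u ++ [:: top, top & v]))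
          (raises s t).
Proof.
apply: (iffP idP).
- elim: s t => [|x s IH] [|y t] //= /or3P[/and3P[/eqP-> my /eqP->]|/andP[/eqP-> st]|].
  + by left; exists [::], t, y.
  + case: (IH _ st) => [[u [v [i [mi -> ->]]]]|[u [v [-> ->]]]].
      by left; exists (y :: u), v, i.
    by right; exists (y :: u), v.
  + case/and5P => /eqP-> /eqP->; case: s {IH} => // x' s /=; case: t => // y' t /=.
    by move=> /eqP[->] /eqP[->] /eqP->; right; exists [::], t.
- case=> [[u [v [i [mi -> ->]]]]|[u [v [-> ->]]]]; elim: u => [|x u IH] /=.
  + by rewrite mi !eqxx.
  + by rewrite IH eqxx /= orbT.
  + by rewrite !eqxx !orbT.
  + by rewrite IH eqxx /= orbT.
Qed.

Lemma raises_size s t : raises s t -> size s = size t.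
Proof.
by move=> /raisesP[[u [v [i [_ -> ->]]]]|[u [v [-> ->]]]]; rewrite !size_cat.
Qed.

(** This strict decrease is what gives each edge a single orientation. *)
Lemma raises_count_zero s t :
  raises s t -> count_mem zero t < count_mem zero s.
Proof.
move=> /raisesP[[u [v [i [mi -> ->]]]]|[u [v [-> ->]]]]; rewrite !count_cat /=.
  by case/andP: mi; case: (i =P zero) => [->|_] //; lia.
by rewrite top_neq_zero; lia.
Qed.

(** Agreement away from the changed positions is the same as a common prefix and a common suffix
    around a factor of length one or two. *)
Lemma raises_tupleE n (s t : n.-tuple letter) :
  replace_letter s t || replace_pair s t = raises s t.
Proof.
have ssz : size s = n by rewrite size_tuple.
have tsz : size t = n by rewrite size_tuple.
have szst : size s = size t by rewrite ssz tsz.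
apply/orP/raisesP => [[/existsP[p]|/existsP[p /existsP[p']]]|].
- case/and3P; rewrite !(tnth_nth zero) => /eqP sp mp /forallP H; left.
  have [q|Et Ed] := @eq_take_drop _ zero s t p p.+1 szst (leqnSn p).
    move=> qp; case: (ltnP q n) => qn; last by rewrite !nth_default ?ssz ?tsz.
    have qp' : q != p by lia.
    have := H (Ordinal qn); rewrite -val_eqE /= qp' /= !(tnth_nth zero) /=.
    by move=> /eqP->.
  exists (take p s), (drop p.+1 s), (nth zero t p); split=> //.
    by rewrite -sp -drop_nth ?ssz // cat_take_drop.
  by rewrite Et Ed -drop_nth ?tsz // cat_take_drop.
- case/and4P; rewrite !(tnth_nth zero) => /eqP pp' /andP[/eqP sp /eqP sp'].
  move=> /andP[/eqP tp /eqP tp'] /forallP H; right.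
  have p'n := ltn_ord p'; rewrite pp' in sp' tp' p'n.
  have [q|Et Ed] :=
    @eq_take_drop _ zero s t p p.+2 szst (leqW (leqnSn p)).
    move=> qp; case: (ltnP q n) => qn; last by rewrite !nth_default ?ssz ?tsz.
    have [q1 q2] : q != p /\ q != p.+1 by lia.
    have := H (Ordinal qn); rewrite -!val_eqE /= pp' q1 q2 /= !(tnth_nth zero) /=.
    by move=> /eqP/val_inj->.
  exists (take p s), (drop p.+2 s); split=> //.
    by rewrite -{1}sp -sp' -!drop_nth ?ssz // 1?ltnW // cat_take_drop.
  by rewrite Et Ed -{1}tp -tp' -!drop_nth ?tsz // 1?ltnW // cat_take_drop.
- case=> [[u [v [i [mi su tu]]]]|[u [v [su tu]]]].
  + left; have un : size u < n by rewrite -ssz su size_cat /=; lia.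
    apply/existsP; exists (Ordinal un); rewrite !(tnth_nth zero) /=.
    rewrite {1}su tu !nth_cat ltnn subnn /= (mi : 0 < i < k) /=.
    apply/forallP => q; apply/implyP.
    rewrite -val_eqE /= !(tnth_nth zero) su tu !nth_cat.
    (* Beyond the changed letter the offset [q - size u] is a successor, so both words read the
       common suffix [v]. *)
    by case: ltngtP => // uq _; rewrite -(subnSK uq).
  + right; have un : (size u).+1 < n by rewrite -ssz su size_cat /=; lia.
    apply/existsP; exists (Ordinal (ltnW un)).
    apply/existsP; exists (Ordinal un); rewrite !(tnth_nth zero) /=.
    rewrite {1 2}su tu !nth_cat !ltnn !subnn ltnNge leqnSn subSnn /= ?eqxx /=.
    apply/forallP => q; apply/implyP.
    rewrite -!val_eqE /= !(tnth_nth zero) su tu !nth_cat.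
    case: (ltngtP q (size u)) => //= uq uq'.
    by rewrite -(subnSK uq) -subnSK //; lia.
Qed.

(** * Enumeration of words and arcs by their first block *)

Definition low_letters : seq letter := enum (predC1 top).
Definition middle_letters : seq letter := enum [pred i | middle i].

Lemma size_low_letters : size low_letters = k.
Proof. by rewrite -cardE cardC1 card_ord. Qed.

Lemma size_middle_letters : size middle_letters = k.-1.
Proof.
(* The letters 0 and k are distinct since k is positive, which leaves (k + 1) - 2 letters. *)
have E : predC (pred2 zero top) =i [pred i | middle i].
  by move=> [i ik]; rewrite !inE -!val_eqE /= /middle /=; lia.
rewrite -cardE -(eq_card E).
by have /(congr1 (subn^~ 2)) := cardC (pred2 zero top);
  rewrite card2 zero_neq_top card_ord addKn subSS subn1.
Qed.

Fixpoint pell_words n : seq (seq letter) :=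
  if n is m.+1 then
    [seq c :: w | c <- low_letters, w <- pell_words m] ++
    (if m is m'.+1 then [seq [:: top, top & w] | w <- pell_words m'] else [::])
  else [:: [::]].

Fixpoint arcs n : seq (seq letter * seq letter) :=
  if n is m.+1 then
    [seq (c :: p.1, c :: p.2) | c <- low_letters, p <- arcs m] ++
    [seq (zero :: w, c :: w) | c <- middle_letters, w <- pell_words m] ++
    (if m is m'.+1 then
       [seq ([:: top, top & p.1], [:: top, top & p.2]) | p <- arcs m'] ++
       [seq ([:: zero, zero & w], [:: top, top & w]) | w <- pell_words m']
     else [::])
  else [::].

Lemma size_pell_words n :
  size (pell_words n.+2) = k * size (pell_words n.+1) + size (pell_words n).
Proof. by rewrite [LHS]size_cat size_allpairs size_map size_low_letters. Qed.

Lemma size_arcs n :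
  size (arcs n.+2) = k * size (arcs n.+1) + k.-1 * size (pell_words n.+1)
                     + size (arcs n) + size (pell_words n).
Proof.
rewrite [LHS]size_cat [X in _ + X]size_cat [X in _ + (_ + X)]size_cat.
by rewrite !size_allpairs !size_map size_low_letters size_middle_letters !addnA.
Qed.

Lemma mem_low_letters x : (x \in low_letters) = (x != top).
Proof. by rewrite mem_enum. Qed.

Lemma mem_middle_letters x : (x \in middle_letters) = middle x.
Proof. by rewrite mem_enum. Qed.

Lemma pell_word_cons x s :
  pell_word (x :: s) =
  if x == top then (ohead s == Some top) && pell_word (behead s)
  else pell_word s.
Proof.
by rewrite /pell_word /=; case: (x == top); case: s => //= y s.
Qed.

(** The first letter determines the first block. The induction is strong because the block kk leaves
    a word shorter by two. *)
Lemma mem_pell_words n s : (s \in pell_words n) = (size s == n) && pell_word s.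
Proof.
elim/ltn_ind: n s => -[|n] IH s; first by rewrite inE; case: s.
rewrite mem_cat; apply/orP/andP => [[/allpairsP[[c w] /= [cl wn ->]]|]|].
- rewrite mem_low_letters in cl; rewrite IH // in wn.
  by rewrite pell_word_cons (negbTE cl) /= eqSS; apply/andP.
- case: n IH => // n IH /mapP[w wn ->]; rewrite IH // in wn.
  by rewrite pell_word_cons eqxx /= eqxx !eqSS; apply/andP.
- case: s => [[]//|x s]; rewrite pell_word_cons /= eqSS => -[/eqP sz].
  case: eqVneq => [->|xt] ps; [right|left].
    case: s sz ps => [|y s] //= sz /andP[/eqP[->] ps]; subst n.
    by apply/map_f; rewrite IH // eqxx.
  by apply/allpairsP; exists (x, s); rewrite mem_low_letters IH // sz eqxx.
Qed.

Lemma uniq_pell_words n : uniq (pell_words n).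
Proof.
elim/ltn_ind: n => -[|n] IH //; rewrite cat_uniq; apply/and3P; split.
- apply: allpairs_uniq; [exact: enum_uniq|exact: IH|].
  by move=> [c w] [c' w'] _ _ [-> ->].
- case: n {IH} => // n; apply/hasPn => _ /mapP[w _ ->].
  apply/allpairsP => -[[c v] /= [cl _ [tc _]]].
  by rewrite -tc mem_low_letters eqxx in cl.
- case: n IH => // n IH; rewrite map_inj_uniq ?IH //.
  by move=> v w [->].
Qed.

(** Both ends must be required to be Pell: k00k raises to the Pell word kkkk without being Pell
    itself. *)
Lemma mem_arcs n s t :
  ((s, t) \in arcs n) =
  [&& size s == n, pell_word s, pell_word t & raises s t].
Proof.
elim/ltn_ind: n s t => -[|n] IH s t.
  by rewrite in_nil; case: s => [|x s] //=; rewrite andbF.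
rewrite !mem_cat; apply/or3P/and4P => [[]|].
- case/allpairsP=> -[c [s' t']] /= [cl].
  rewrite IH // => /and4P[sz ps pt r] [-> ->].
  rewrite mem_low_letters in cl.
  by rewrite !pell_word_cons (negbTE cl) /= eqSS eqxx r orbT.
- case/allpairsP=> -[c w] /= [cl].
  rewrite mem_pell_words => /andP[sz pw] [-> ->].
  rewrite mem_middle_letters in cl.
  have ct : c == top = false by rewrite -val_eqE /=; case/andP: cl; lia.
  by rewrite !pell_word_cons zero_neq_top ct /= eqSS !eqxx cl.
- case: n IH => // n IH; rewrite mem_cat => /orP[/mapP[[s' t']]|/mapP[w]].
    rewrite IH // => /and4P[sz ps pt r] [-> ->].
    by rewrite !pell_word_cons eqxx /= !eqSS !eqxx r /= !orbT.
  rewrite mem_pell_words => /andP[sz pw] [-> ->].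
  by rewrite !pell_word_cons zero_neq_top eqxx /= !eqSS !eqxx !orbT.
- case: s => [[]//|x s]; case: t => [[]//|y t] [/=]; rewrite eqSS => sz ps pt.
  case/or3P=> [/and3P[/eqP x0 my /eqP st]|/andP[/eqP xy r]|].
  + constructor 2; apply/allpairsP; exists (y, s) => /=.
    rewrite mem_middle_letters mem_pell_words sz x0 -st; split=> //.
    by rewrite pell_word_cons x0 zero_neq_top in ps.
  + subst y; case: (eqVneq x top) => [xt|xt]; last first.
      constructor 1; apply/allpairsP; exists (x, (s, t)); split=> //=.
        by rewrite mem_low_letters.
      by rewrite !pell_word_cons (negbTE xt) in ps pt; rewrite IH // sz ps pt.
    (* A common leading k forces a second k in both words. As k is not 0, the change cannot start at
       that second letter, so it lies after the whole block kk. *)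
    subst x; constructor 3.
    move: ps pt; rewrite !pell_word_cons eqxx.
    case: s sz r => [|x s] //= sz r /andP[/eqP[xt] ps].
    case: t r => [|y t] //= r /andP[/eqP[yt] pt].
    move: r; rewrite xt yt top_neq_zero eqxx /= orbF => r.
    case: n sz IH => // n sz IH; rewrite mem_cat; apply/orP; left.
    by apply/mapP; exists (s, t); rewrite // IH //; apply/and4P.
  + case/and5P => /eqP x0 /eqP yt; subst x y.
    move: ps; rewrite pell_word_cons zero_neq_top.
    case: s sz => [|x s] //= sz ps /eqP[x0].
    case: t pt => [|y t] //= pt /eqP[yt] /eqP st.
    subst x y t; constructor 3.
    case: n sz IH => // n sz IH; rewrite mem_cat; apply/orP; right.
    apply/mapP; exists s => //; rewrite mem_pell_words; apply/andP; split=> //.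
    by rewrite pell_word_cons zero_neq_top in ps.
Qed.

(** The pair of first letters separates the four kinds of arcs: (c, c) with c low, (0, c) with c
    middle, (k, k) and (0, k). *)
Lemma uniq_arcs n : uniq (arcs n).
Proof.
elim/ltn_ind: n => -[|n] IH //; rewrite !cat_uniq; apply/and5P; split.
- apply: allpairs_uniq; [exact: enum_uniq|exact: IH|].
  by move=> [c [v w]] [c' [v' w']] _ _ [-> -> _ ->].
- apply/hasPn => p; rewrite mem_cat.
  apply: contraTN => /allpairsP[[c [v w]] /= [cl _ ->]].
  rewrite mem_low_letters in cl; rewrite negb_or; apply/andP; split.
    apply/allpairsP => -[[c' w']] /= [cm _ [c0 _ cc' _]].
    by move: cm; rewrite -cc' c0 mem_middle_letters.
  case: n {IH} => // n; rewrite mem_cat negb_or; apply/andP; split.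
    by apply/mapP => -[q _ [ct _]]; rewrite ct eqxx in cl.
  by apply/mapP => -[q _ [_ _ ct _]]; rewrite ct eqxx in cl.
- apply: allpairs_uniq; [exact: enum_uniq|exact: uniq_pell_words|].
  by move=> [c w] [c' w'] _ _ [_ -> ->].
- case: n {IH} => // n; apply/hasPn => p; rewrite mem_cat.
  apply: contraTN => /allpairsP[[c w]] /= [cl _ ->].
  rewrite mem_middle_letters in cl.
  rewrite negb_or; apply/andP; split; apply/mapP => -[q _ E].
    by have /eqP := congr1 (head zero \o fst) E; rewrite /= zero_neq_top.
  have /= ct := congr1 (head zero \o snd) E.
  by move: cl; rewrite ct /middle /= ltnn andbF.
- case: n IH => // n IH; rewrite cat_uniq; apply/and3P; split.
  + by rewrite map_inj_uniq ?IH // => -[v w] [v' w'] [-> ->].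
  + apply/hasPn => _ /mapP[w _ ->]; apply/mapP => -[q _ E].
    by have /eqP := congr1 (head zero \o fst) E; rewrite /= zero_neq_top.
  + by rewrite map_inj_uniq ?uniq_pell_words // => v w [->].
Qed.

(** * Edges of the Munarini graph counted by arcs *)

Lemma card_munarini_edges n : #|munarini_edges n k| = size (arcs n).
Proof.
pose word_of (x : munarini_vertex n k) : seq letter := val (val x).
have word_inj : injective word_of by move=> x y /val_inj/val_inj.
pose D := [set p | raises (word_of p.1) (word_of p.2)].
have -> : munarini_edges n k = [set [set p.1; p.2] | p in D].
  apply/setP => e; rewrite inE.
  apply/existsP/imsetP => [[x /existsP[y]]|[[x y]]].
    have -> : munarini_adj x y =
        raises (word_of x) (word_of y) || raises (word_of y) (word_of x).
      by rewrite -!raises_tupleE orbACA -orbA.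
    case/andP=> /orP[] r /eqP->; first by exists (x, y); rewrite ?inE.
    by exists (y, x); rewrite ?inE //= setUC.
  rewrite inE /= -raises_tupleE => r ->; exists x; apply/existsP; exists y.
  by rewrite eqxx /munarini_adj andbT; case/orP: r => ->; rewrite ?orbT.
(* Forgetting the orientation is injective on [D]: a swapped pair would make the number of zeros
   decrease in both directions, and a collapsed pair would make it smaller than itself. *)
rewrite card_in_imset => [|[x y] [x' y']]; last first.
  rewrite !inE /= => /raises_count_zero r /raises_count_zero r' /setP E.
  have := E x; have := E y; rewrite !inE !eqxx orbT /=.
  move=> /esym/orP[] /eqP yE /esym/orP[] /eqP xE; rewrite xE yE // in r *.
  - by rewrite ltnn in r.
  - by have := ltn_trans r r'; rewrite ltnn.
  - by rewrite ltnn in r.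
rewrite cardE -(size_map (fun p => (word_of p.1, word_of p.2))).
(* The underlying words of [D] and the list [arcs n] are duplicate-free with the same elements. *)
apply/perm_size/uniq_perm; last 1 first.
- move=> [s t]; rewrite mem_arcs; apply/mapP/and4P => [[[x y]]|[sz ps pt r]].
    rewrite mem_enum inE /= => r [-> ->]; split=> //.
    + by rewrite size_tuple.
    + by rewrite -pell_stringE; apply: (valP x).
    + by rewrite -pell_stringE; apply: (valP y).
  have szt : size t == n by rewrite -(raises_size r).
  have psx : pell_string (Tuple sz) by rewrite pell_stringE.
  have psy : pell_string (Tuple szt) by rewrite pell_stringE.
  exists (exist _ (Tuple sz) psx, exist _ (Tuple szt) psy) => //.
  by rewrite mem_enum inE.
- rewrite map_inj_uniq ?enum_uniq // => -[x y] [x' y'].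
  by case=> /word_inj-> /word_inj->.
- exact: uniq_arcs.
Qed.
End PellWords.

Local Open Scope ring_scope.

(** * Ring laws for formal power series *)

Section FormalPowerSeriesAlgebra.

Variable R : comUnitRingType.
Implicit Types (a b c : fps R) (p q : {poly R}).

Lemma eq_fps_mul a a' b b' :
  a =1 a' -> b =1 b' -> fps_mul a b =1 fps_mul a' b'.
Proof. by move=> Ea Eb n; apply: eq_bigr => i _; rewrite Ea Eb. Qed.

(** Coefficients up to degree [n] see only the truncations at that degree, so commutativity and
    associativity can be borrowed from polynomials. *)
Lemma fps_mul_trunc a b n m : (m <= n)%N ->
  fps_mul a b m = (\poly_(i < n.+1) a i * \poly_(i < n.+1) b i)`_m.
Proof.
move=> mn; rewrite coefM; apply: eq_bigr => i _.
by rewrite !coef_poly !ifT //; have := ltn_ord i; lia.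
Qed.

Lemma fps_mulC a b : fps_mul a b =1 fps_mul b a.
Proof. by move=> n; rewrite !(@fps_mul_trunc _ _ n n) // mulrC. Qed.

Lemma fps_mulA a b c : fps_mul a (fps_mul b c) =1 fps_mul (fps_mul a b) c.
Proof.
move=> n; pose tr u := \poly_(i < n.+1) (u i : R).
transitivity (tr a * (tr b * tr c))`_n; last rewrite mulrA.
  rewrite coefM; apply: eq_bigr => i _.
  by rewrite -fps_mul_trunc ?leq_subr // coef_poly ltn_ord.
rewrite coefM; apply: eq_bigr => i _.
rewrite -fps_mul_trunc ?coef_poly ?ifT //; have := ltn_ord i; lia.
Qed.

Lemma fps_of_polyM p q :
  fps_of_poly (p * q) =1 fps_mul (fps_of_poly p) (fps_of_poly q).
Proof. by move=> n; rewrite /fps_of_poly coefM. Qed.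

Lemma fps_mulr1 a : fps_mul a (fps_of_poly 1) =1 a.
Proof.
move=> n; rewrite /fps_mul /fps_of_poly big_ord_recr big1 /= => [|i _].
  by rewrite subnn coef1 mulr1 add0r.
by rewrite coef1 subn_eq0 leqNgt ltn_ord mulr0.
Qed.

Lemma fps_div_eq a b c : b 0%N \is a GRing.unit ->
  fps_mul c b =1 a -> c =1 fps_div a b.
Proof.
move=> ub cb n; rewrite /fps_div -(eq_fps_mul cb (frefl _)) -fps_mulA.
rewrite (eq_fps_mul (frefl c) (fps_mulC _ _)).
by rewrite (eq_fps_mul (frefl c) (fps_mulVr ub)) fps_mulr1.
Qed.

(** This translates a second-order linear recurrence with its two initial values into an identity of
    series. *)
Lemma fps_mul_quadratic a (u v w : R) :
  let b := fps_of_poly (u%:P + v *: 'X + w *: 'X^2) in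
  [/\ fps_mul a b 0%N = u * a 0%N,
      fps_mul a b 1%N = u * a 1%N + v * a 0%N &
      forall n, fps_mul a b n.+2 = u * a n.+2 + v * a n.+1 + w * a n].
Proof.
have C i : (u%:P + v *: 'X + w *: 'X^2)`_i =
    if i is j.+1 then if j is l.+1 then if l is _.+1 then 0 else w else v else u.
  rewrite !coefD coefC !coefZ coefX coefXn.
  by case: i => [|[|[|i]]]; rewrite /= ?mulr1 ?mulr0 ?addr0 ?add0r.
rewrite /fps_mul /fps_of_poly; split=> [||n].
- by rewrite big_ord1 C mulrC.
- by rewrite 2!big_ord_recr big_ord0 /= !C /= add0r addrC !(mulrC _ (a _)).
(* Only the last three terms survive: for [i < n] the quadratic is read at an index of at least
   3. *)
rewrite 3!big_ord_recr big1 /= => [|i _]; last first.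
  have -> : (n.+2 - i = (n - i.+1).+3)%N by have := ltn_ord i; lia.
  by rewrite C mulr0.
rewrite subnn subSnn !C -addn2 addKn /= add0r addrC (addrC (a n * w)) addrA.
by rewrite !(mulrC (a _)).
Qed.

End FormalPowerSeriesAlgebra.

Theorem proposition2p6 (k : nat) (hk : (1 <= k)%N) :
  (fun n : nat => #|munarini_edges n k|%:R : int) =1
  fps_div
    (fps_of_poly ((k%:R - 1) *: 'X + 'X^2 : {poly int}))
    (fps_of_poly ((1 - k%:R *: 'X - 'X^2) ^+ 2 : {poly int})).
Proof.
pose E : fps int := fun n => (size (arcs k n))%:R.
pose F : fps int := fun n => (size (pell_words k n))%:R.
pose B : {poly int} := 1 - k%:R *: 'X - 'X^2.
pose A : {poly int} := (k%:R - 1) *: 'X + 'X^2.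
have EE : (fun n => #|munarini_edges n k|%:R : int) =1 E.
  by move=> n; rewrite card_munarini_edges.
have BE : B = 1%:P + (- k%:R) *: 'X + (-1) *: 'X^2.
  by rewrite scaleNr scaleN1r.
have B0 : B`_0 = 1.
  by rewrite /B !coefB coef1 coefZ coefX coefXn mulr0 !subr0.
have AE : A = 0%:P + (k%:R - 1) *: 'X + 1 *: 'X^2.
  by rewrite scale1r polyC0 add0r.
(* Truncated subtraction agrees with integer subtraction because k is at least 1. *)
have kE : (k.-1)%:R = k%:R - 1 :> int by rewrite -subn1 natrB.
(* The recurrences start at length 2, so the counts at length 1 are computed apart. *)
have s0 : size (pell_words k 1) = k.
  by rewrite [LHS]size_cat size_allpairs size_low_letters muln1 addn0.
have a0 : size (arcs k 1) = k.-1.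
  rewrite [LHS]size_cat [X in (_ + X)%N]size_cat !size_allpairs.
  by rewrite size_middle_letters // muln0 muln1 addn0.
have FB : fps_mul F (fps_of_poly B) =1 fps_of_poly 1.
  rewrite BE; have [H0 H1 H2] := fps_mul_quadratic F 1 (- k%:R) (-1).
  case=> [|[|n]]; rewrite ?H0 ?H1 ?H2 /fps_of_poly coef1 /F ?s0 ?size_pell_words.
  - by [].
  - by rewrite /= mul1r mulr1 subrr.
  - by rewrite natrD natrM /=; ring.
have EB : fps_mul E (fps_of_poly B) =1 fps_mul F (fps_of_poly A).
  rewrite BE AE; have [H0 H1 H2] := fps_mul_quadratic E 1 (- k%:R) (-1).
  have [G0 G1 G2] := fps_mul_quadratic F 0 (k%:R - 1) 1.
  case=> [|[|n]]; rewrite ?H0 ?H1 ?H2 ?G0 ?G1 ?G2 /E /F ?s0 ?a0 ?size_arcs //.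
  - by rewrite kE /=; ring.
  - by rewrite !natrD !natrM kE; ring.
move=> n; rewrite EE; apply: fps_div_eq => [|{}n].
  by rewrite -/B /fps_of_poly expr2 coefM big_ord1 /= B0 mulr1 unitr1.
(* The chain is E (B B) = (E B) B = (F A) B = A (F B) = A. *)
rewrite -/A -/B expr2 (eq_fps_mul (frefl E) (fps_of_polyM B B)).
rewrite fps_mulA (eq_fps_mul EB (frefl _)) (eq_fps_mul (fps_mulC _ _) (frefl _)).
by rewrite -fps_mulA (eq_fps_mul (frefl _) FB) fps_mulr1.
Qed.
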